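(* Let $n\ge 2$ and let $G$ be isomorphic to the Hanaki group $A(n,\mathcal V)$, where $\mathcal V$ is the Frobenius automorphism $x\mapsto x^2$ of the field $GF(2^n)$. Let $\Gamma_G$ be the non-commuting graph of $G$. Then: (a) $E(\Gamma_G)=LE(\Gamma_G)=LE^+(\Gamma_G)$. (b) $\Gamma_G$ is not hypoenergetic, not hyperenergetic, not L-hyperenergetic and not Q-hyperenergetic.
   Context: The group $A(n,\mathcal V)$ consists of the matrices $U(a,b)=\begin{bmatrix}1&0&0\\ a&1&0\\ b&\mathcal V(a)&1\end{bmatrix}$ with $a,b\in GF(2^n)$, under matrix multiplication, so $U(a,b)U(a',b')=U(a+a',\,b+b'+a'\mathcal V(a))$. For a finite non-abelian group $G$ with center $Z(G)$, the non-commuting graph $\Gamma_G$ is the simple undirected graph with vertex set $G\setminus Z(G)$ in which $x,y$ are adjacent iff $xy\ne yx$. For a finite simple graph $\mathcal G$ with vertex set $v(\mathcal G)$, edge set $e(\mathcal G)$, adjacency matrix $A(\mathcal G)$ and diagonal degree matrix $D(\mathcal G)$, put $L(\mathcal G)=D(\mathcal G)-A(\mathcal G)$ (Laplacian) and $Q(\mathcal G)=D(\mathcal G)+A(\mathcal G)$ (signless Laplacian). With sums over eigenvalues counted with multiplicity, define $E(\mathcal G)=\sum_{\lambda}|\lambda|$ ($\lambda$ eigenvalues of $A(\mathcal G)$), $LE(\mathcal G)=\sum_{\beta}\left|\beta-\frac{2|e(\mathcal G)|}{|v(\mathcal G)|}\right|$ ($\beta$ eigenvalues of $L(\mathcal G)$),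 $LE^+(\mathcal G)=\sum_{\gamma}\left|\gamma-\frac{2|e(\mathcal G)|}{|v(\mathcal G)|}\right|$ ($\gamma$ eigenvalues of $Q(\mathcal G)$). With $K_n$ the complete graph on $n$ vertices, $\mathcal G$ is called hyperenergetic if $E(\mathcal G)>E(K_{|v(\mathcal G)|})$, hypoenergetic if $E(\mathcal G)<|v(\mathcal G)|$, L-hyperenergetic if $LE(\mathcal G)>LE(K_{|v(\mathcal G)|})$, and Q-hyperenergetic if $LE^+(\mathcal G)>LE^+(K_{|v(\mathcal G)|})$. *)

(* Defs.v *)
From HB Require Import structures.
From mathcomp Require Import all_boot all_order all_algebra.
From mathcomp Require Import all_fingroup all_solvable all_field.
From mathcomp Require Import ring.

Set Implicit Arguments.
Unset Strict Implicit.
Unset Printing Implicit Defensive.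

Import Order.TTheory GRing.Theory Num.Theory.
Local Open Scope ring_scope.

Record sgraph := SGraph {
  vertex :> finType;
  adj : rel vertex;
  adj_sym : symmetric adj;
  adj_irr : irreflexive adj }.
Arguments adj {s} : rename.

Lemma complete_sym n : symmetric (fun i j : 'I_n => i != j).
Proof. by move=> i j; rewrite eq_sym. Qed.

Lemma complete_irr n : irreflexive (fun i j : 'I_n => i != j).
Proof. by move=> i; rewrite eqxx. Qed.

Definition complete n : sgraph := SGraph (@complete_sym n) (@complete_irr n).

Section Energy.
Variable G : sgraph.

Definition edges : {set {set G}} :=
  [set f | [exists x, exists y, adj x y && (f == [set x; y])]].

Definition degree (x : G) : nat := #|[set y | adj x y]|.

(* Rows and columns are indexed through the canonical enumeration of the
   vertices. *)
Definition adjacency_mx : 'M[algC]_#|G| :=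
  \matrix_(i, j) (adj (enum_val i) (enum_val j))%:R.

Definition degree_mx : 'M[algC]_#|G| :=
  diag_mx (\row_i (degree (enum_val i))%:R).

Definition laplacian_mx := degree_mx - adjacency_mx.
Definition signless_laplacian_mx := degree_mx + adjacency_mx.
End Energy.

(* The roots of the characteristic polynomial, listed with multiplicity; see
   spectrumP.  These matrices have integer entries, so algC contains all their
   complex eigenvalues. *)
Definition spectrum n (A : 'M[algC]_n) : seq algC :=
  sval (closed_field_poly_normal (char_poly A)).

Lemma spectrumP n (A : 'M[algC]_n) :
  char_poly A = \prod_(z <- spectrum A) ('X - z%:P).
Proof.
rewrite /spectrum; case: closed_field_poly_normal => s /= {1}->.
by rewrite (monicP (char_poly_monic A)) scale1r.
Qed.

Section Energies.
Variable G : sgraph.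

Definition mean_degree : algC := (2 * #|edges G|)%:R / #|G|%:R.

Definition energy : algC :=
  \sum_(l <- spectrum (adjacency_mx G)) `|l|.

Definition laplacian_energy : algC :=
  \sum_(b <- spectrum (laplacian_mx G)) `|b - mean_degree|.

Definition signless_laplacian_energy : algC :=
  \sum_(c <- spectrum (signless_laplacian_mx G)) `|c - mean_degree|.

(* The order of algC is partial, but by the lemmas below all the quantities
   compared in the next definitions are nonnegative reals. *)
Lemma energy_ge0 : 0 <= energy.
Proof. exact: sumr_ge0. Qed.

Lemma laplacian_energy_ge0 : 0 <= laplacian_energy.
Proof. exact: sumr_ge0. Qed.

Lemma signless_laplacian_energy_ge0 : 0 <= signless_laplacian_energy.
Proof. exact: sumr_ge0. Qed.
End Energies.

Definition hyperenergetic (G : sgraph) : bool :=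
  energy G > energy (complete #|G|).

Definition hypoenergetic (G : sgraph) : bool :=
  energy G < #|G|%:R.

Definition L_hyperenergetic (G : sgraph) : bool :=
  laplacian_energy G > laplacian_energy (complete #|G|).

Definition Q_hyperenergetic (G : sgraph) : bool :=
  signless_laplacian_energy G > signless_laplacian_energy (complete #|G|).

Section NonCommutingGraph.
Variables (gT : finGroupType) (G : {group gT}).

Definition noncentral : finType := {x : gT | x \in G :\: 'Z(G)%g}.

Definition noncommuting : rel noncentral :=
  fun x y => (val x * val y != val y * val x)%g.

Lemma noncommuting_sym : symmetric noncommuting.
Proof. by move=> x y; rewrite /noncommuting eq_sym. Qed.

Lemma noncommuting_irr : irreflexive noncommuting.
Proof. by move=> x; rewrite /noncommuting eqxx. Qed.

Definition noncommuting_graph : sgraph :=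
  SGraph noncommuting_sym noncommuting_irr.
End NonCommutingGraph.

Section Hanaki.
Variables (F : finFieldType) (V : {rmorphism F -> F}).

Definition hanaki_mx (a b : F) : 'M[F]_3 :=
  \matrix_(i, j) nth 0 (nth [::] [:: [:: 1; 0;   0];
                                     [:: a; 1;   0];
                                     [:: b; V a; 1]] i) j.

Lemma hanaki_mxM a b a' b' :
  hanaki_mx a b *m hanaki_mx a' b' = hanaki_mx (a + a') (b + b' + a' * V a).
Proof.
apply/matrixP=> i j; rewrite !mxE !big_ord_recl big_ord0 !mxE /=.
by case: i j => [[|[|[|//]]] Hi] [[|[|[|//]]] Hj] //=;
  rewrite ?rmorphD; ring.
Qed.

Lemma hanaki_mx0 : hanaki_mx 0 0 = 1%:M.
Proof.
apply/matrixP=> i j; rewrite !mxE /=.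
by case: i j => [[|[|[|//]]] Hi] [[|[|[|//]]] Hj] //=; rewrite rmorph0.
Qed.

Lemma hanaki_mx_unit a b : hanaki_mx a b \is a GRing.unit.
Proof.
suff /mulmx1_unit[] : hanaki_mx a b *m hanaki_mx (- a) (- b + a * V a) = 1%:M.
  by [].
by rewrite hanaki_mxM -hanaki_mx0; congr hanaki_mx; ring.
Qed.

Definition hanaki_elt (a b : F) : {'GL_3[F]} :=
  FinRing.Unit (hanaki_mx_unit a b).

Definition hanaki_set : {set {'GL_3[F]}} :=
  [set hanaki_elt u.1 u.2 | u : F * F].

Lemma hanaki_group_set : group_set hanaki_set.
Proof.
apply/group_setP; split=> [|_ _ /imsetP[[a b] _ ->] /imsetP[[a' b'] _ ->]] /=.
  by apply/imsetP; exists (0, 0) => //; apply: val_inj; rewrite /= hanaki_mx0.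
apply/imsetP; exists (a + a', b + b' + a' * V a) => //.
by apply: val_inj; rewrite /= -hanaki_mxM.
Qed.

Definition hanaki_group : {group {'GL_3[F]}} := Group hanaki_group_set.
End Hanaki.

Definition frobenius (F : finFieldType) (n : nat) (cardF : #|F| = (2 ^ n)%N) :
    {rmorphism F -> F} :=
  pFrobenius_aut (card_finPcharP cardF (isT : prime 2)).

Lemma frobeniusE (F : finFieldType) (n : nat) (cardF : #|F| = (2 ^ n)%N) x :
  frobenius cardF x = x ^+ 2.
Proof. by []. Qed.

(* Main.v *)
(* In A(n, V) with V the Frobenius map, U(a, b) and U(a', b') commute iff
   a' a^2 = a a'^2, that is iff a = 0, a' = 0 or a = a'.  Hence the
   non-commuting graph is complete multipartite, the 2^n - 1 parts of size 2^n
   being indexed by a != 0.  A complete multipartite graph with N vertices and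
   parts of equal size m is regular of degree k = N - m, so that
   E = LE = LE+, and its adjacency eigenvalues lie in {0, -m, k}.  On these
   three values |x| agrees with (2 x^2 + (m - k) x) / N, so the energy follows
   from tr A = 0 and tr A^2 = N k without computing multiplicities: E = 2 k.
   The complete graph is the case m = 1, of energy 2 (N - 1), and N <= 2 k
   since there are at least two parts. *)
Require Import Defs.
From mathcomp Require Import all_boot all_order all_algebra.
From mathcomp Require Import all_fingroup all_solvable all_field.
From mathcomp Require Import ring.
Set Implicit Arguments.
Unset Strict Implicit.
Unset Printing Implicit Defensive.

Import Order.TTheory GRing.Theory Num.Theory.
Local Open Scope ring_scope.

(** * Spectra of affine images of a real symmetric matrix *)

Lemma char_poly_conj (R : comUnitRingType) n (P B : 'M[R]_n) :
  P \in unitmx -> char_poly (invmx P *m B *m P) = char_poly B.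
Proof.
move=> uP; rewrite /char_poly /char_poly_mx !map_mxM /=.
(* Scalar matrices are fixed by conjugation, so the whole characteristic matrix gets conjugated. *)
have XE : 'X%:M = map_mx polyC (invmx P) *m 'X%:M *m map_mx polyC P.
  by rewrite scalar_mxC -mulmxA -map_mxM /= mulVmx // map_scalar_mx mulmx1.
rewrite {1}XE -mulmxBl -mulmxBr !det_mulmx mulrAC -det_mulmx -map_mxM /=.
by rewrite mulVmx // map_scalar_mx det1 mul1r.
Qed.

(** A real symmetric matrix is normal over [algC], so the spectral theorem applies. *)
Lemma real_symmetric_diagonalization n (A : 'M[algC]_n) :
    (forall i j, A i j = A j i) -> (forall i j, A i j \is Num.real) ->
  exists P d, P \in unitmx /\ A = invmx P *m diag_mx d *m P.
Proof.
move=> symA realA; exists (spectralmx A), (spectral_diag A).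
split; first exact: spectral_unit.
apply/orthomx_spectralP/symmetric_normalmx; last exact/mxOverP.
apply/is_hermitianmxP; rewrite expr0 scale1r.
by apply/matrixP=> i j; rewrite !mxE symA.
Qed.

(** The same [P] diagonalizes every affine image. For a k-regular graph, taking c = 0 or k and e = 1
    or -1 covers all three graph matrices. *)
Lemma spectrum_affine n (P : 'M[algC]_n) d c e : P \in unitmx ->
  perm_eq (spectrum (c%:M + e *: (invmx P *m diag_mx d *m P)))
    [seq c + e * d 0 i | i : 'I_n].
Proof.
move=> uP; apply: prod_XsubC_eq.
have -> : c%:M + e *: (invmx P *m diag_mx d *m P) =
    invmx P *m diag_mx (\row_i (c + e * d 0 i)) *m P.
  have -> : diag_mx (\row_i (c + e * d 0 i)) = c%:M + e *: diag_mx d.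
    by apply/matrixP=> i j; rewrite !mxE mulrnDl mulrnAr.
  rewrite mulmxDr mulmxDl -scalemxAr -scalemxAl -[c%:M]mulmx1; congr (_ + _).
  by rewrite mulmx1 scalar_mxC -mulmxA mulVmx ?mulmx1.
rewrite -spectrumP char_poly_conj // char_poly_trig ?diag_mx_is_trig //.
by rewrite big_image; apply: eq_bigr => i _; rewrite !mxE eqxx.
Qed.

Lemma mxtrace_conj_diag (R : comUnitRingType) n (P : 'M[R]_n) d :
  P \in unitmx -> \tr (invmx P *m diag_mx d *m P) = \sum_i d 0 i.
Proof.
by move=> uP; rewrite mxtrace_mulC mulmxA mulmxV // mul1mx mxtrace_diag.
Qed.

(** * Edge counts and energies of regular graphs *)

Lemma handshake (H : sgraph) : (2 * #|edges H| = \sum_(x : H) @degree H x)%N.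
Proof.
(* Both sides count ordered pairs of adjacent vertices; each edge comes from exactly two of them, as
   there are no loops. *)
transitivity #|[set p : H * H | @adj H p.1 p.2]|.
  pose ends (p : H * H) := [set p.1; p.2].
  rewrite -[RHS]sum1_card (partition_big ends (mem (edges H))) /=.
    rewrite mulnC -sum_nat_const; apply: eq_bigr => f.
    rewrite inE => /existsP[x /existsP[y /andP[xy /eqP->]]].
    rewrite sum1dep_card.
    have xNy : x != y by apply: contraTneq xy => ->; rewrite adj_irr.
    transitivity #|[set (x, y); (y, x)]|.
      by rewrite cards2 xpair_eqE negb_and xNy.
    apply: eq_card => -[u v]; rewrite !inE !xpair_eqE /=.
    apply/idP/idP=> [|].
      case/orP=> /andP[/eqP-> /eqP->]; first by rewrite xy eqxx.
      by rewrite adj_sym xy setUC eqxx.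
    case/andP=> uv /eqP E.
    have uNv : u != v by apply: contraTneq uv => ->; rewrite adj_irr.
    have: u \in [set x; y] by rewrite -E set21.
    have: v \in [set x; y] by rewrite -E set22.
    rewrite !inE.
    case/orP=> /eqP vE /orP[]/eqP uE; rewrite uE vE !eqxx ?orbT //.
      by rewrite uE vE eqxx in uNv.
    by rewrite uE vE eqxx in uNv.
  move=> [x y]; rewrite inE /= => xy; rewrite inE.
  by apply/existsP; exists x; apply/existsP; exists y; rewrite xy eqxx.
rewrite -sum1dep_card.
rewrite -(pair_big_dep xpredT (fun x y : H => @adj H x y) (fun _ _ => 1%N)) /=.
by apply: eq_bigr => x _; rewrite sum1dep_card.
Qed.

(** [d] is chosen before [c] and [e], so that all the spectra are written with the same
    eigenvalues. *)
Lemma spectrum_adjacency_affine (G : sgraph) :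
  exists P d, [/\ P \in unitmx, adjacency_mx G = invmx P *m diag_mx d *m P &
    forall c e : algC, perm_eq (spectrum (c%:M + e *: adjacency_mx G))
                        [seq c + e * d 0 i | i : 'I_#|G|] ].
Proof.
have [||P [d [uP AE]]] := real_symmetric_diagonalization (A := adjacency_mx G).
- by move=> i j; rewrite !mxE adj_sym.
- by move=> i j; rewrite mxE realn.
by exists P, d; split=> // c e; rewrite AE spectrum_affine.
Qed.

Lemma energy_diag (G : sgraph) (d : 'rV[algC]_#|G|) :
  perm_eq (spectrum (0%:M + 1 *: adjacency_mx G))
    [seq 0 + 1 * d 0 i | i : 'I_#|G|] ->
  energy G = \sum_i `|d 0 i|.
Proof.
rewrite raddf0 add0r scale1r /energy => /(perm_big _)-> /=.
by rewrite big_image; apply: eq_bigr => i _; rewrite add0r mul1r.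
Qed.

(** The degree matrix is k times the identity and the mean degree is k, so the recentred eigenvalues
    are the adjacency eigenvalues up to sign. *)
Lemma regular_laplacian_energy (G : sgraph) k :
    (0 < #|G|)%N -> (forall x : G, @degree G x = k) ->
  laplacian_energy G = energy G /\ signless_laplacian_energy G = energy G.
Proof.
move=> G_gt0 degG; have [P [d [_ _ spec]]] := spectrum_adjacency_affine G.
have meanE : mean_degree G = k%:R.
  rewrite /mean_degree handshake (eq_bigr _ (fun x _ => degG x)) sum_nat_const.
  by rewrite natrM mulrC mulKf // pnatr_eq0 -lt0n.
have degE : degree_mx G = k%:R%:M.
  by apply/matrixP=> i j; rewrite !mxE degG.
have lapE : laplacian_mx G = k%:R%:M + (-1) *: adjacency_mx G.
  by rewrite scaleN1r /laplacian_mx degE.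
have qlapE : signless_laplacian_mx G = k%:R%:M + 1 *: adjacency_mx G.
  by rewrite scale1r /signless_laplacian_mx degE.
rewrite (energy_diag (spec 0 1)) /laplacian_energy /signless_laplacian_energy.
rewrite meanE lapE qlapE !(perm_big _ (spec _ _)) /= !big_image.
by split; apply: eq_bigr => i _; rewrite addrC addKr ?mulN1r ?normrN ?mul1r.
Qed.

(** * Complete multipartite graphs with equal parts, given by a colouring [c] *)

Section CompleteMultipartite.
Variables (G : sgraph) (T : eqType) (c : G -> T) (m : nat).
Hypothesis adjE : forall x y, @adj G x y = (c x != c y).
Hypothesis card_part : forall x, #|[set y | c y == c x]| = m.

(** The non-neighbours of a vertex, itself included, form its part. *)
Lemma degree_multipartite x : @degree G x = (#|G| - m)%N.
Proof.
have /= := cardsCs [set y | c y == c x].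
rewrite card_part /degree => ->.
have -> : ~: [set y | c y == c x] = [set y | @adj G x y].
  by apply/setP=> y; rewrite !inE adjE eq_sym.
by rewrite subKn // max_card.
Qed.

Lemma card_part_le : (0 < #|G|)%N -> (0 < m <= #|G|)%N.
Proof.
case/card_gt0P=> x _; rewrite -(card_part x) max_card andbT.
by apply/card_gt0P; exists x; rewrite inE.
Qed.

Let A := adjacency_mx G.
Let J : 'M[algC]_#|G| := const_mx 1.

Lemma reindex_enum_val (F : G -> algC) :
  \sum_(i < #|G|) F (enum_val i) = \sum_x F x.
Proof. by rewrite -big_enum_val. Qed.

Lemma adjacency_mulJ : A *m J = (#|G| - m)%:R *: J.
Proof.
apply/matrixP=> i j; rewrite !mxE mulr1 -(degree_multipartite (enum_val i)).
rewrite /degree -sum1dep_card natr_sum [RHS]big_mkcond /=.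
rewrite -[RHS]reindex_enum_val.
by apply: eq_bigr => k _; rewrite !mxE mulr1; case: adj.
Qed.

(** Common neighbours of x and y are the neighbours of x outside the part of y; that part lies
    wholly in the neighbourhood of x or, if x belongs to it, wholly outside. *)
Lemma adjacency_sqr : A *m A = (#|G| - m)%:R *: J - m%:R *: A.
Proof.
apply/matrixP=> i j; rewrite !mxE mulr1.
rewrite -(degree_multipartite (enum_val i)) /degree.
rewrite -(card_part (enum_val j)) -!sum1dep_card !natr_sum mulr_suml.
rewrite [X in _ = X - _]big_mkcond [X in _ = _ - X]big_mkcond /= -sumrB.
rewrite -[RHS]reindex_enum_val.
apply: eq_bigr => k _; rewrite !mxE !adjE.
case: (c (enum_val k) =P c (enum_val j)) => [->|_].
  by rewrite mulr0 mul1r; case: ifP; rewrite subrr.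
by rewrite mulr1 subr0; case: ifP.
Qed.

Lemma energy_multipartite : (0 < #|G|)%N -> energy G = (2 * (#|G| - m))%:R.
Proof.
move=> G_gt0; have /andP[m_gt0 lemG] := card_part_le G_gt0.
have N0 : #|G|%:R != 0 :> algC by rewrite pnatr_eq0 -lt0n.
have [P [d [uP AE spec]]] := spectrum_adjacency_affine G.
have := adjacency_sqr; have := adjacency_mulJ.
set k := (#|G| - m)%N => AJ A2.
have NE : #|G|%:R = k%:R + m%:R :> algC by rewrite -natrD subnK.
(* Multiply the formula for A^2 by A, then use it again to eliminate [J]: A is a root of x (x + m)
   (x - k). *)
have A3 : A *m (A *m A) = (k%:R - m%:R) *: (A *m A) + (k%:R * m%:R) *: A.
  rewrite [in LHS]A2 mulmxBr -!scalemxAr AJ.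
  have -> : k%:R *: J = A *m A + m%:R *: A by rewrite A2 subrK.
  by apply/matrixP=> i j; rewrite !mxE; ring.
have AP : P *m A = diag_mx d *m P.
  by rewrite /A AE !mulmxA mulmxV // mul1mx.
have sqrD : A *m A = invmx P *m diag_mx (\row_i d 0 i ^+ 2) *m P.
  rewrite {1}/A AE -!mulmxA AP [_ *m (_ *m P)]mulmxA mulmx_diag.
  by congr (_ *m (diag_mx _ *m _)); apply/rowP=> i; rewrite !mxE expr2.
(* Apply A^3 = (k - m) A^2 + k m A to the eigenvector [row i P]. *)
have rootd i : d 0 i * (d 0 i + m%:R) * (d 0 i - k%:R) = 0.
  have PiE : row i P *m A = d 0 i *: row i P.
    rewrite -row_mul AP; apply/rowP=> j; rewrite !mxE (bigD1 i) //= !mxE eqxx.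
    rewrite mulr1n big1 ?addr0 // => l li.
    by rewrite !mxE eq_sym (negPf li) mul0r.
  have := congr1 (mulmx (row i P)) A3.
  rewrite mulmxDr -!scalemxAr !mulmxA !(PiE, =^~ scalemxAl) => eqd.
  have Pi0 : row i P != 0.
    apply: contra_eq_neq (mulmxV uP) => Pi0; apply/eqP=> /(congr1 (row i)).
    rewrite row_mul Pi0 mul0mx => /rowP/(_ i)/eqP.
    by rewrite !mxE eqxx eq_sym oner_eq0.
  apply/eqP; rewrite -[_ == 0]orbF -(negPf Pi0) -scaler_eq0.
  apply/eqP/rowP=> j; move/rowP/(_ j)/eqP: eqd; rewrite !mxE -subr_eq0 => /eqP.
  by move<-; ring.
(* The quadratic through (0, 0), (-m, m) and (k, k), where N = k + m. *)
have absd i : `|d 0 i| =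
    2 / #|G|%:R * d 0 i ^+ 2 + (m%:R - k%:R) / #|G|%:R * d 0 i.
  have /eqP := rootd i; rewrite !mulf_eq0 subr_eq0 addr_eq0 -orbA.
  case/or3P=> /eqP->; rewrite ?normrN ?normr0 ?normr_nat NE.
  - by ring.
  - by field; rewrite -NE.
  - by field; rewrite -NE.
rewrite (energy_diag (spec 0 1)) (eq_bigr _ (fun i _ => absd i)) big_split /=.
rewrite -!mulr_sumr.
have -> : \sum_i d 0 i = 0.
  rewrite -(mxtrace_conj_diag d uP) -AE /mxtrace big1 // => i _.
  by rewrite mxE adj_irr.
(* As A has zero diagonal, every diagonal entry of A^2 is k. *)
have -> : \sum_i d 0 i ^+ 2 = #|G|%:R * k%:R.
  transitivity (\tr (A *m A)).
    by rewrite sqrD mxtrace_conj_diag //; apply: eq_bigr => i _; rewrite mxE.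
  rewrite A2 /mxtrace (eq_bigr (fun _ => k%:R)) => [|i _].
    by rewrite sumr_const card_ord mulr_natl.
  by rewrite !mxE adj_irr mulr1 mulr0 subr0.
by rewrite mulr0 addr0 natrM mulrA divfK.
Qed.
End CompleteMultipartite.

(** The identity colouring makes all parts singletons. *)
Lemma energy_complete n : (0 < n)%N -> energy (complete n) = (2 * (n - 1))%:R.
Proof.
move=> n_gt0; have N : #|complete n| = n by rewrite card_ord.
rewrite -[in RHS]N; apply: (@energy_multipartite (complete n) 'I_n id) => //.
- by move=> x; rewrite -[RHS](cards1 x); apply: eq_card => y; rewrite !inE.
- by rewrite N.
Qed.

(** * Commutation of the matrices U(a, b) *)

Section Hanaki.
Variables (F : finFieldType) (V : {rmorphism F -> F}).

Lemma hanaki_eltM a b a' b' :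
  (hanaki_elt V a b * hanaki_elt V a' b')%g =
  hanaki_elt V (a + a') (b + b' + a' * V a).
Proof. by apply: val_inj; rewrite /= -hanaki_mxM. Qed.

Lemma hanaki_elt10 a b : val (hanaki_elt V a b) (inord 1) (inord 0) = a.
Proof. by rewrite /= mxE !inordK. Qed.

Lemma hanaki_elt20 a b : val (hanaki_elt V a b) (inord 2) (inord 0) = b.
Proof. by rewrite /= mxE !inordK. Qed.

(** The two products agree except possibly in the corner entry, where b + b' cancels. *)
Lemma hanaki_elt_commute a b a' b' :
  (hanaki_elt V a b * hanaki_elt V a' b' ==
   hanaki_elt V a' b' * hanaki_elt V a b)%g = (a' * V a == a * V a').
Proof.
rewrite !hanaki_eltM; apply/eqP/eqP => [E | ->]; last first.
  by rewrite addrC [b + _]addrC.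
move/(congr1 (fun M : {'GL_3[F]} => val M (inord 2) (inord 0))): E.
by rewrite !hanaki_elt20 [b' + b]addrC => /addrI.
Qed.
End Hanaki.

(** * The non-commuting graph for the Frobenius map *)

Section FrobeniusHanaki.
Variables (n : nat) (F : finFieldType) (cardF : #|F| = (2 ^ n)%N).
Let H := hanaki_group (frobenius cardF).
Let U := hanaki_elt (frobenius cardF).

(** The corner entries differ by a a' (a - a'), and a field has no zero divisors. *)
Lemma frobenius_hanaki_commute a b a' b' :
  (U a b * U a' b' == U a' b' * U a b)%g = [|| a == 0, a' == 0 | a == a'].
Proof.
rewrite hanaki_elt_commute !frobeniusE -subr_eq0.
have -> : a' * a ^+ 2 - a * a' ^+ 2 = a * (a' * (a - a')) by ring.
by rewrite !mulf_eq0 subr_eq0.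
Qed.

Hypothesis n_ge2 : (2 <= n)%N.

(** Since n >= 2, the field has at least four elements. *)
Lemma exists_other_element (a : F) : exists2 b : F, b != 0 & a != b.
Proof.
have : ~~ (setT \subset [set 0; a]).
  apply: contraL n_ge2 => /subset_leq_card; rewrite cardsT cardF => le2.
  rewrite -ltnNge -(ltn_exp2l (m := 2)) //; apply: leq_ltn_trans le2 _.
  by rewrite cards2; case: (_ != _).
case/subsetPn=> b _; rewrite !inE negb_or => /andP[b0 ba].
by exists b; rewrite // eq_sym.
Qed.

Variables (gT : finGroupType) (G : {group gT}).
Variables (f : {morphism G >-> {'GL_3[F]}}) (inj_f : ('injm f)%g).
Hypothesis (imf : (f @* G)%g = H).

Lemma hanaki_preimage a b : exists2 x, x \in G & f x = U a b.
Proof.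
have : U a b \in (f @* G)%g by rewrite imf; apply/imsetP; exists (a, b).
by case/morphimP=> x Gx _ ->; exists x.
Qed.

Lemma hanaki_image x : x \in G -> exists a b, f x = U a b.
Proof.
move=> Gx; have : f x \in (f @* G)%g by apply: mem_morphim.
by rewrite imf => /imsetP[[a b] _ ->]; exists a, b.
Qed.

Lemma commute_morph x y : x \in G -> y \in G ->
  (x * y == y * x)%g = (f x * f y == f y * f x)%g.
Proof.
move=> Gx Gy; rewrite -!morphM //.
by apply/eqP/eqP=> [-> // | /(injmP inj_f)]; apply; rewrite groupM.
Qed.

(** The parameter a of [f x] = U(a, b), read off a matrix entry to give a total function; its
    nonzero values index the parts of the graph. *)
Definition hanaki_class (x : gT) : F := val (f x) (inord 1) (inord 0).

Lemma hanaki_classE x a b : f x = U a b -> hanaki_class x = a.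
Proof. by rewrite /hanaki_class => ->; apply: hanaki_elt10. Qed.

Lemma commute_hanaki_class x y : x \in G -> y \in G ->
  (x * y == y * x)%g =
  [|| hanaki_class x == 0, hanaki_class y == 0
    | hanaki_class x == hanaki_class y].
Proof.
move=> Gx Gy; have [a [b fx]] := hanaki_image Gx.
have [a' [b' fy]] := hanaki_image Gy.
rewrite commute_morph // (hanaki_classE fx) (hanaki_classE fy) fx fy.
exact: frobenius_hanaki_commute.
Qed.

(** If the class of x is nonzero, an element whose class is neither 0 nor that of x fails to commute
    with x. *)
Lemma hanaki_center x : x \in G -> (x \in 'Z(G)%g) = (hanaki_class x == 0).
Proof.
move=> Gx; apply/centerP/eqP=> [[_ cx] | x0].
  have [a' a'0 xa'] := exists_other_element (hanaki_class x).
  have [y Gy fy] := hanaki_preimage a' 0.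
  have /eqP := cx y Gy; rewrite commute_hanaki_class // (hanaki_classE fy).
  by rewrite (negPf a'0) (negPf xa') !orbF => /eqP.
by split=> // y Gy; apply/eqP; rewrite commute_hanaki_class // x0 eqxx.
Qed.

Let Gamma := noncommuting_graph G.

Lemma noncentral_vertex (x : Gamma) : val x \in G /\ hanaki_class (val x) != 0.
Proof.
have := valP x; rewrite inE => /andP[xZ Gx]; split=> //.
by rewrite -hanaki_center.
Qed.

Lemma adj_hanaki (x y : Gamma) :
  adj x y = (hanaki_class (val x) != hanaki_class (val y)).
Proof.
have [Gx x0] := noncentral_vertex x; have [Gy y0] := noncentral_vertex y.
rewrite /adj /= /noncommuting commute_hanaki_class //.
by rewrite (negPf x0) (negPf y0).
Qed.

Lemma vertex_of_class a b : a != 0 -> exists x : Gamma, f (val x) = U a b.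
Proof.
move=> a0; have [x Gx fx] := hanaki_preimage a b.
have xV : x \in G :\: 'Z(G)%g.
  by rewrite inE hanaki_center // (hanaki_classE fx) a0.
by exists (Sub x xV).
Qed.

(** [f] maps the part of x bijectively onto the matrices U(a, b) with a fixed and b running through
    F. *)
Lemma card_hanaki_class (x : Gamma) :
  #|[set y : Gamma | hanaki_class (val y) == hanaki_class (val x)]| = #|F|.
Proof.
set S := [set y | _]; have [_ x0] := noncentral_vertex x.
set a := hanaki_class (val x) in S x0 *.
have inj_fv : injective (fun y : Gamma => f (val y)).
  move=> y z E; apply/val_inj/(injmP inj_f) => //.
    by case: (noncentral_vertex y).
  by case: (noncentral_vertex z).
have inj_U : injective (U a).
  move=> b b' E; rewrite -(hanaki_elt20 (frobenius cardF) a b) -/U E.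
  exact: hanaki_elt20.
rewrite -(card_imset S inj_fv) -(card_codom inj_U) -cardsE; apply: eq_card => u.
rewrite inE; apply/imsetP/codomP=> [[y yS ->] | [b ->]].
  have [Gy _] := noncentral_vertex y; have [a' [b fy]] := hanaki_image Gy.
  by move: yS; rewrite inE (hanaki_classE fy) => /eqP <-; exists b.
have [y fy] := vertex_of_class b x0; exists y => //.
by rewrite inE (hanaki_classE fy).
Qed.

Lemma exists_adj_hanaki : exists x y : Gamma, adj x y.
Proof.
(* Preimages of U(1, 0) and U(a, 0), with a different from 0 and 1, are adjacent. *)
have [a a0 a1] := exists_other_element 1.
have [x fx] := vertex_of_class 0 (oner_neq0 F).
have [y fy] := vertex_of_class 0 a0.
by exists x, y; rewrite adj_hanaki (hanaki_classE fx) (hanaki_classE fy).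
Qed.
End FrobeniusHanaki.

(** * Comparison of the energies *)

Lemma multipartite_energies (G : sgraph) (T : eqType) (c : G -> T) m :
    (forall x y : G, adj x y = (c x != c y)) ->
    (forall x, #|[set y | c y == c x]| = m) ->
    (exists x y : G, adj x y) ->
  (energy G = laplacian_energy G /\
   laplacian_energy G = signless_laplacian_energy G) /\
  [/\ ~ hypoenergetic G, ~ hyperenergetic G, ~ L_hyperenergetic G &
      ~ Q_hyperenergetic G].
Proof.
move=> adjE card_part [x [y xy]].
have G_gt0 : (0 < #|G|)%N by apply/card_gt0P; exists x.
have degG := degree_multipartite adjE card_part.
have /andP[m_gt0 lemG] := card_part_le card_part G_gt0.
(* The part of y lies in the neighbourhood of x, which has N - m elements. *)
have m_le : (m <= #|G| - m)%N.
  rewrite -(degG x) -(card_part y) /degree; apply/subset_leq_card/subsetP=> z.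
  by rewrite !inE adjE => /eqP->; rewrite -adjE.
have [LE QE] := regular_laplacian_energy G_gt0 degG.
have degK (z : complete #|G|) : degree z = (#|G| - 1)%N.
  transitivity #|[set~ z]|; last by rewrite cardsC1 card_ord subn1.
  by apply: eq_card => w; rewrite !inE eq_sym.
have K_gt0 : (0 < #|complete #|G| |)%N by rewrite card_ord.
have [LK QK] := regular_laplacian_energy K_gt0 degK.
(* Here 2 (N - m) <= 2 (N - 1), as parts are nonempty. *)
have leK : energy G <= energy (complete #|G|).
  rewrite (energy_multipartite adjE card_part G_gt0) energy_complete //.
  by rewrite ler_nat leq_mul2l leq_sub2l.
split; first by rewrite LE QE.
(* Both graphs being regular, the three comparisons with the complete graph become the same one. *)
rewrite /hyperenergetic /L_hyperenergetic /Q_hyperenergetic LE QE LK QK.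
rewrite le_gtF //.
split=> //; rewrite /hypoenergetic.
rewrite (energy_multipartite adjE card_part G_gt0) ltr_nat.
(* Since N - (N - m) = m, the bound N <= 2 (N - m) amounts to m <= N - m. *)
by apply/negP; rewrite -leqNgt mul2n -addnn -leq_subLR subKn.
Qed.

Theorem theorem5p3 (n : nat) (n_ge2 : (2 <= n)%N)
    (F : finFieldType) (cardF : #|F| = (2 ^ n)%N)
    (gT : finGroupType) (G : {group gT})
    (isoG : G \isog hanaki_group (frobenius cardF)) :
  let Gamma := noncommuting_graph G in
  (energy Gamma = laplacian_energy Gamma /\
   laplacian_energy Gamma = signless_laplacian_energy Gamma) /\
  [/\ ~ hypoenergetic Gamma,
      ~ hyperenergetic Gamma,
      ~ L_hyperenergetic Gamma &
      ~ Q_hyperenergetic Gamma].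
Proof.
case/isogP: isoG => f inj_f imf Gamma.
apply: (multipartite_energies (c := fun x : Gamma => hanaki_class f (val x))).
- exact: (adj_hanaki n_ge2 inj_f imf).
- exact: (card_hanaki_class n_ge2 inj_f imf).
- exact: (exists_adj_hanaki n_ge2 inj_f imf).
Qed.
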